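(* Let $k$ be a positive integer, let $K$ be a real number, and let $A$ be a finite set of integers with $|A|\ge2$ such that $\omega(a)\le k$ for all $a\in A$ and $|A\cdot A|\le K|A|$. Then there are a set $P=\{p_1,\ldots,p_r\}$ of $r\le k$ distinct primes and a set $\tilde A\subseteq A$ with \[|\tilde A|\ \ge\ \frac{|A|}{2^k\,k!\,(\log_2|A|)^k},\] together with structural decompositions \[\tilde A=\bigcup_{\mathbf v\in V}\mathbf p^{\mathbf v}\cdot B_{\mathbf v}=\bigcup_{b\in B}b\cdot\Gamma_b,\] where $V\subseteq\mathbb{N}_0^r$, each $B_{\mathbf v}$ is a finite set of integers coprime to $p_1\cdots p_r$, the set $B=\bigcup_{\mathbf v\in V}B_{\mathbf v}$ satisfies \[|B|\ \le\ \frac{4^{k+2}K|A|}{|\tilde A|},\] and each $\Gamma_b$ is a subset of $\langle p_1,\ldots,p_r\rangle$ whose size satisfies $L\le|\Gamma_b|\le2L$, for some $L\geq 1$ (the same for all $b\in B$).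
   Context: For an integer $a$, $\omega(a)$ is the number of distinct primes dividing $a$ (every prime divides $0$, so $\omega(0)=\infty$ and the condition $\omega(a)\le k$ forces $a\ne 0$). $A\cdot A=\{ab:a,b\in A\}$ and $d\cdot X=\{dx:x\in X\}$. For $\mathbf p=(p_1,\ldots,p_r)$ and $\mathbf v=(v_1,\ldots,v_r)$ an integer tuple, $\mathbf p^{\mathbf v}=p_1^{v_1}\cdots p_r^{v_r}$, and $\langle p_1,\ldots,p_r\rangle=\{\mathbf p^{\mathbf v}:\mathbf v\in\mathbb{Z}^r\}\subseteq\mathbb{Q}^\times$ is the multiplicative group generated by the primes. The case $r=0$ is allowed (the empty product is $1$ and the group is $\{1\}$). $\mathbb{N}_0$ denotes the non-negative integers. *)

(* Defs.v *)
From HB Require Import structures.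
From mathcomp Require Import all_boot all_order all_algebra.
From mathcomp Require Import finmap.
From mathcomp Require Import all_classical all_reals all_analysis.

Set Implicit Arguments.
Unset Strict Implicit.
Unset Printing Implicit Defensive.

Import Order.TTheory GRing.Theory Num.Theory.

Local Open Scope classical_set_scope.
Local Open Scope ring_scope.

(* Every prime divides 0, hence the infinite value there ([primes 0] is empty
   by convention). *)
Definition omega (a : int) : \bar int :=
  if a == 0 then +oo%E else ((size (primes `|a|))%:Z)%:E.

Definition log2 (R : realType) (x : R) : R := ln x / ln 2.

Definition product_set (A : {fset int}) : {fset int} :=
  [fset x * y | x in A, y in A]%fset.

Definition dilate (d : rat) (X : set rat) : set rat := [set d * x | x in X].

(* A finite set of integers seen inside the rationals, where dilations by
   elements of the multiplicative group of Q take place. *)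
Definition ratset (X : {fset int}) : set rat :=
  [set x%:~R | x in [set` X]].

Definition prime_power (r : nat) (p : 'I_r -> nat) (v : 'rV[int]_r) : rat :=
  \prod_(i < r) (p i)%:R ^ v 0 i.

Definition prime_group (r : nat) (p : 'I_r -> nat) : set rat :=
  range (prime_power p).

Definition nonneg_vectors (r : nat) : set 'rV[int]_r :=
  [set v | forall i, 0 <= v 0 i].

(* Main.v *)
Require Import Defs.
From HB Require Import structures.
From mathcomp Require Import all_boot all_order all_algebra.
From mathcomp Require Import finmap zify.
From mathcomp Require Import all_classical all_reals all_analysis.

Set Implicit Arguments.
Unset Strict Implicit.
Unset Printing Implicit Defensive.

Import Order.TTheory GRing.Theory Num.Theory.

Local Open Scope classical_set_scope.
Local Open Scope ring_scope.

(** For a finite set [P] of primes, write every nonzero [a] as a positive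
integer built from [P] times [coprime_part P a], the signed part of [a] prime
to [P].  Call [X] regular when all fibers of [coprime_part P] on [X] have size
between [l] and [2 l]; the theorem asks for a large regular subset [X] of [A]
whose set [B] of coprime parts is small.  The construction starts from
[X = A], [P] empty, [l = 1] and follows a dichotomy.

If at least half of the pairs of [X] have coprime coprime parts, [X] is good
enough ([coprime_pairs_bound]).  Indeed, given the product [x] of such a pair,
the coprime part of the first factor is, up to sign, a unitary divisor of the
coprime part of [x], which has at most [2 k] primes; this leaves
[2 * 4 ^ k] values, and [2 l] elements of [X] over each.  Hence
[|X| ^ 2 / 2 <= |A A| * 2 * 4 ^ k * 2 l], and since [|B| l <= |X|] this gives
[|B| |X| <= 8 * 4 ^ k |A A|].

Otherwise some [a] in [X] has a coprime part that is not coprime to those of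
at least half of [X], so one of its at most [k - |P|] primes divides the
coprime parts of at least [|X| / (2 (k - |P|))] elements ([popular_prime]).
Keep these elements and add that prime to [P]; a dyadic pigeonhole on the sizes
of the new fibers restores regularity at the cost of a factor
[m = floor (log2 |A|)] ([dyadic_fibers], [regular_step]).  All primes of [P]
divide all elements of [X], so this happens at most [k] times, and the total
loss is at most [2 ^ k * k! * m ^ k].

The vectors of the theorem are the [P]-adic valuations of the elements of [X],
and [Gamma b] collects the [P]-parts of the elements of [X] above [b]. *)

(** * Counting in fibers *)

Section Counting.
Local Open Scope nat_scope.

Lemma sum_const_seq (T : Type) (s : seq T) (n : nat) :
  \sum_(t <- s) n = size s * n.
Proof. by rewrite big_const_seq iter_addn_0 count_predT mulnC. Qed.

Lemma pigeonhole_sum (T : eqType) (s : seq T) (F : T -> nat) (n : nat) :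
  0 < n <= \sum_(t <- s) F t -> exists2 t, t \in s & n <= size s * F t.
Proof.
case/andP=> n_gt0 le_n; have [/hasP[t ts nt]|/hasPn no_t] :=
  boolP (has (fun t => n <= size s * F t) s); first by exists t.
have s_gt0 : 0 < size s by case: s le_n {no_t} => //=; rewrite big_nil; lia.
have: size s * n <= size s * n.-1; last by rewrite leq_pmul2l //; lia.
apply: leq_trans (leq_mul (leqnn _) le_n) _.
rewrite big_distrr /=.
apply: (@leq_trans (\sum_(t <- s) n.-1)).
  by rewrite !big_seq; apply: leq_sum => t /no_t; lia.
by rewrite sum_const_seq.
Qed.

Lemma sum_eq_uniq (T : eqType) (s : seq T) (x : T) :
  uniq s -> \sum_(t <- s) (x == t) = (x \in s).
Proof.
move=> us; rewrite -(count_uniq_mem x us) -sum1_count [RHS]big_mkcond /=.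
by apply: eq_bigr => t _; rewrite eq_sym; case: eqP.
Qed.

Lemma sum_eq_mem (T : eqType) (s : seq T) (x : T) :
  (x \in s) <= \sum_(t <- s) (x == t).
Proof.
by elim: s => // t s IH; rewrite big_cons inE; case: (x == t) => //=; lia.
Qed.

Lemma count_sum (T : Type) (s : seq T) (a : pred T) :
  count a s = \sum_(x <- s) a x.
Proof.
by rewrite -sum1_count big_mkcond; apply: eq_bigr => x _; case: (a x).
Qed.

Lemma count_mem_image (T U : eqType) (f : T -> U) (s : seq T) (t : seq U) :
  count (fun x => f x \in t) s <= \sum_(u <- t) count (fun x => f x == u) s.
Proof.
under eq_bigr do rewrite count_sum.
rewrite exchange_big count_sum; apply: leq_sum => x _.
exact: sum_eq_mem.
Qed.

Definition fiber_size (T U : eqType) (f : T -> U) (s : seq T) (x : T) : nat :=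
  count (fun y => f y == f x) s.

Lemma fiber_size_gt0 (T U : eqType) (f : T -> U) (s : seq T) (x : T) :
  x \in s -> 0 < fiber_size f s x.
Proof. by move=> xs; rewrite -has_count; apply/hasP; exists x. Qed.

Lemma fibers_lower_bound (T U : eqType) (f : T -> U) (s : seq T) (l : nat) :
  (forall x, x \in s -> l <= fiber_size f s x) ->
  size (undup (map f s)) * l <= size s.
Proof.
move=> lef; have -> : size s = count (fun x => f x \in undup (map f s)) s.
  by symmetry; apply/eqP; rewrite -all_count; apply/allP => x xs; rewrite mem_undup map_f.
rewrite count_sum.
under [X in _ <= X]eq_bigr do rewrite -sum_eq_uniq ?undup_uniq //.
rewrite exchange_big /= -sum_const_seq big_seq [X in _ <= X]big_seq.
apply: leq_sum => u; rewrite mem_undup => /mapP[x xs ->].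
apply: leq_trans (lef x xs) _; rewrite /fiber_size count_sum.
by apply: eq_leq.
Qed.

(** The intervals [[2 ^ j, 2 ^ (j + 1)]] with [j < m] overlap at their endpoints
and so cover all sizes up to [2 ^ m], with [m] classes rather than [m + 1].  A
fiber that is larger than [2 ^ m] contains more than half of [s], and all of
[s] when [m = 1], so that it is enough on its own. *)
Lemma dyadic_fibers (T U : eqType) (f : T -> U) (s : seq T) (m : nat) :
  0 < m -> 0 < size s < 2 ^ m.+1 ->
  exists2 l, 0 < l &
    size s <= m * count (fun x => l <= fiber_size f s x <= 2 * l) s.
Proof.
move=> m_gt0 /andP[s_gt0 s_lt].
have [/hasP[x xs x_big]|/hasPn no_big] :=
    boolP (has (fun x => 2 ^ m < fiber_size f s x) s).
  exists (fiber_size f s x); first exact: fiber_size_gt0.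
  have le_f : fiber_size f s x <=
      count (fun y => fiber_size f s x <= fiber_size f s y <= 2 * fiber_size f s x) s.
    apply: sub_count => y /= /eqP eqf.
    by rewrite /fiber_size eqf leqnn /= mul2n -addnn leq_addr.
  apply: leq_trans (leq_mul (leqnn m) le_f).
  have : fiber_size f s x <= size s by exact: count_size.
  move: s_lt x_big; rewrite expnS.
  (* For m = 1 the bounds 2 < fiber and size s < 4 give equality; for m > 1
     twice the fiber already exceeds size s. *)
  case: m m_gt0 {le_f} => // -[|m] _; first lia.
  nia.
(* The truncation at m.-1 sends the size 2 ^ m, the right end of the last
   interval, to that interval. *)
have cover : size s <= \sum_(j <- iota 0 m)
    count (fun x => 2 ^ j <= fiber_size f s x <= 2 * 2 ^ j) s.
  have -> : size s = \sum_(x <- s) 1 by rewrite sum1_size.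
  under [X in _ <= X]eq_bigr do rewrite count_sum.
  rewrite exchange_big big_seq [X in _ <= X]big_seq; apply: leq_sum => x xs.
  have := fiber_size_gt0 f xs; have := no_big x xs.
  rewrite -leqNgt; move: (fiber_size f s x) => c c_le c_gt0.
  set j := minn (trunc_log 2 c) m.-1.
  have j_in : j \in iota 0 m by rewrite mem_iota /j; lia.
  rewrite (bigD1_seq j) ?iota_uniq //=.
  suff -> : 2 ^ j <= c <= 2 * 2 ^ j by [].
  have /andP[lo hi] := trunc_log_bounds (isT : 1 < 2) c_gt0.
  apply/andP; split.
    by apply: leq_trans lo; rewrite leq_exp2l // geq_minl.
  rewrite -expnS /j; case: (leqP (trunc_log 2 c) m.-1) => _; first exact: ltnW.
  by rewrite prednK.
have /pigeonhole_sum[j _] := introT andP (conj s_gt0 cover).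
by rewrite size_iota => le; exists (2 ^ j); first by rewrite expn_gt0.
Qed.

(** Selecting whole fibers does not change their sizes, so regularity of the
fibers can be imposed by discarding the others. *)
Lemma fiber_size_filter (T U : eqType) (f : T -> U) (s : seq T) (a : pred T) x :
  (forall y, f y = f x -> a y = a x) -> a x ->
  fiber_size f [seq y <- s | a y] x = fiber_size f s x.
Proof.
move=> fa ax; rewrite /fiber_size count_filter; apply: eq_count => y /=.
by case: eqP => //= /fa ->.
Qed.

End Counting.

(** * Parts coprime to a set of primes *)

Section CoprimePart.
Local Open Scope nat_scope.

Definition coprime_part (P : seq nat) (a : int) : int :=
  (sgz a * ((`|a|)`_([pred p in P] : nat_pred)^')%:Z)%R.

Lemma absz_coprime_part P a : a != 0%R ->
  `|coprime_part P a| = (`|a|)`_([pred p in P] : nat_pred)^'.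
Proof. by move=> a0; rewrite abszM absz_sg a0 mul1n. Qed.

Lemma coprime_partM P a b : a != 0%R -> b != 0%R ->
  coprime_part P (a * b)%R = (coprime_part P a * coprime_part P b)%R.
Proof.
move=> a0 b0; rewrite /coprime_part sgzM abszM partnM ?absz_gt0 // PoszM.
by rewrite mulrACA.
Qed.

Lemma coprime_partK P a : a != 0%R ->
  a = (((`|a|)`_([pred p in P] : nat_pred))%:Z * coprime_part P a)%R.
Proof.
move=> a0; rewrite /coprime_part mulrCA -PoszM partnC ?absz_gt0 //.
by rewrite -intEsg.
Qed.

Lemma primes_coprime_part P a p : a != 0%R ->
  (p \in primes `|coprime_part P a|) = (p \notin P) && (p \in primes `|a|).
Proof.
move=> a0; rewrite absz_coprime_part // primes_part mem_filter.
by rewrite inE /= inE.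
Qed.

(** The divisors [d] of [n] with [d] and [n / d] coprime, with both signs: such
a [d] is the part of [n] at a subset of its primes, here encoded by a mask. *)
Definition unitary_divisors (n : nat) : seq int :=
  [seq ((-1) ^+ (e : bool) * (n`_([pred p in mask m (primes n)] : nat_pred))%:Z)%R
     | e <- [:: false; true], m <- codom (fun m : (size (primes n)).-tuple bool => tval m)].

Lemma size_unitary_divisors n : size (unitary_divisors n) = 2 * 2 ^ size (primes n).
Proof. by rewrite size_allpairs size_codom card_tuple card_bool. Qed.

Lemma mem_unitary_divisors (a b : int) : a != 0%R -> b != 0%R ->
  coprime `|a| `|b| -> a \in unitary_divisors (`|a| * `|b|).
Proof.
move=> a0 b0 cab; set n := `|a| * `|b|.
have n0 : 0 < n by rewrite muln_gt0 !absz_gt0 a0 b0.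
pose M := map (fun p => p \in primes `|a|) (primes n).
have sM : size M == size (primes n) by rewrite size_map.
apply/allpairsP; exists ((a < 0)%R, M); split => /=.
- by case: (a < 0)%R.
- by apply/codomP; exists (Tuple sM).
have -> : n`_([pred p in mask M (primes n)] : nat_pred) = `|a|.
  rewrite -filter_mask partnM ?absz_gt0 //.
  have -> : (`|b|)`_([pred p in [seq x <- primes n | x \in primes `|a|]] : nat_pred) = 1.
    apply: part_p'nat; apply/pnatP; rewrite ?absz_gt0 // => p pp pb.
    rewrite !inE /= mem_filter negb_and; apply/orP; left.
    apply/negP; rewrite mem_primes => /and3P[_ _ pa].
    have : p %| gcdn `|a| `|b| by rewrite dvdn_gcd pa.
    by rewrite (eqP cab) dvdn1 => /eqP p1; rewrite p1 in pp.
  rewrite muln1; apply: part_pnat_id; apply/pnatP; rewrite ?absz_gt0 // => p pp pa.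
  have pap : p \in primes `|a| by rewrite mem_primes pp absz_gt0 a0.
  by rewrite !inE mem_filter pap primesM ?absz_gt0 // pap.
exact: intEsign.
Qed.

Definition coprime_parts P (a b : int) : bool :=
  coprime `|coprime_part P a| `|coprime_part P b|.

(** Pairs are counted according to their product, an entry of [T].  For a fixed
product [x], the first factor [a] determines the pair, and its coprime part lies
in the [unitary_divisors] of the coprime part of [x], hence takes at most
[2 * 4 ^ k] values, each on at most [M] elements. *)
Lemma coprime_pairs_bound (P : seq nat) (X T : seq int) (k M : nat) :
  uniq X -> {in X &, forall a b, (a * b)%R \in T} ->
  (forall a, a \in X -> a != 0%R) ->
  (forall a, a \in X -> size (primes `|coprime_part P a|) <= k) ->
  (forall a, a \in X -> fiber_size (coprime_part P) X a <= M) ->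
  \sum_(a <- X) \sum_(b <- X) coprime_parts P a b <= size T * (2 * 4 ^ k * M).
Proof.
move=> uX XT X0 Xk XM.
pose rep x a b := ((a * b)%R == x) && coprime_parts P a b.
apply: (@leq_trans (\sum_(x <- T) \sum_(a <- X) \sum_(b <- X) rep x a b)).
  rewrite [leqRHS]exchange_big /= big_seq [leqRHS]big_seq; apply: leq_sum => a aX.
  rewrite [leqRHS]exchange_big /= big_seq [leqRHS]big_seq; apply: leq_sum => b bX.
  rewrite (big_rem _ (XT a b aX bX)) /= /rep eqxx /=; exact: leq_addr.
rewrite -sum_const_seq; apply: leq_sum => x _.
have [/hasP[a0 a0X /hasP[b0 b0X /andP[/eqP ab0 _]]]|/hasPn none] :=
  boolP (has (fun a => has (rep x a) X) X); last first.
  rewrite big_seq big1 // => a aX; rewrite big_seq big1 // => b bX.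
  by have /hasPn/(_ b bX) /negbTE -> := none a aX.
pose n := `|coprime_part P x|.
have n_eq a b : a \in X -> b \in X -> (a * b)%R = x ->
    n = `|coprime_part P a| * `|coprime_part P b|.
  by move=> aX bX ab; rewrite /n -ab coprime_partM ?X0 // abszM.
have cop0 a : a \in X -> coprime_part P a != 0%R.
  by move=> aX; rewrite -absz_gt0 absz_coprime_part ?X0 // part_gt0.
(* A single representation of x is enough to bound the number of primes. *)
have n_primes : size (primes n) <= 2 * k.
  have : {subset primes n <=
      primes `|coprime_part P a0| ++ primes `|coprime_part P b0|}.
    by move=> p; rewrite (n_eq a0 b0) // primesM ?absz_gt0 ?cop0 // mem_cat.
  move/(uniq_leq_size (primes_uniq _)); rewrite size_cat.
  by move/leq_trans; apply; rewrite mul2n -addnn leq_add ?Xk.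
apply: (@leq_trans (count (fun a => coprime_part P a \in unitary_divisors n) X)).
  rewrite count_sum big_seq [leqRHS]big_seq; apply: leq_sum => a aX.
  have [/hasP[b bX /andP[/eqP ab cab]]|/hasPn none] := boolP (has (rep x a) X).
    rewrite (n_eq a b) // mem_unitary_divisors ?cop0 //.
    apply: (@leq_trans (b \in X)); last by rewrite bX.
    rewrite -(sum_eq_uniq b uX) /=; apply: leq_sum => c _.
    rewrite /rep -ab (inj_eq (mulfI (X0 a aX))) eq_sym.
    by case: eqP => //= _; exact: leq_b1.
  by rewrite big_seq big1 // => b /none /negbTE ->.
apply: leq_trans (count_mem_image _ _ _) _.
apply: (@leq_trans (\sum_(u <- unitary_divisors n) M)).
  apply: leq_sum => u _.
  have [/hasP[a aX /eqP <-]|] := boolP (has (fun a => coprime_part P a == u) X).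
    exact: XM.
  by rewrite has_count -leqNgt leqn0 => /eqP ->.
rewrite sum_const_seq size_unitary_divisors leq_mul2r leq_mul2l /=.
by rewrite (@leq_trans (2 ^ (2 * k))) ?orbT // ?leq_exp2l // expnM.
Qed.

(** Averaging over [a] gives an [a] whose coprime part shares a prime with those
of half of [X]; a second averaging, over the primes of that coprime part, makes
the shared prime constant. *)
Lemma popular_prime (P : seq nat) (X : seq int) :
  (forall a, a \in X -> a != 0%R) ->
  2 * \sum_(a <- X) \sum_(b <- X) coprime_parts P a b < size X ^ 2 ->
  exists a p, [/\ a \in X, p \in primes `|coprime_part P a| &
    size X <= 2 * size (primes `|coprime_part P a|) *
      count (fun b => p \in primes `|coprime_part P b|) X].
Proof.
move=> X0 few.
have total : \sum_(a <- X) \sum_(b <- X) coprime_parts P a b +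
    \sum_(a <- X) \sum_(b <- X) ~~ coprime_parts P a b = size X ^ 2.
  rewrite -big_split /= (eq_bigr (fun=> size X)) => [|a _].
    by rewrite sum_const_seq mulnn.
  rewrite -big_split /= -sum1_size; apply: eq_bigr => b _.
  by case: coprime_parts.
have X_gt0 : 0 < size X by case: (size X) few.
have [|a aX] := @pigeonhole_sum _ X
    (fun a => 2 * \sum_(b <- X) ~~ coprime_parts P a b) (size X ^ 2).
  by rewrite expn_gt0 X_gt0 /= -big_distrr /=; lia.
rewrite -mulnn leq_pmul2l // => Xa.
pose D p := count (fun b => p \in primes `|coprime_part P b|) X.
have cop0 b : b \in X -> coprime_part P b != 0%R.
  by move=> bX; rewrite -absz_gt0 absz_coprime_part ?X0 // part_gt0.
have [|p pa pX] := @pigeonhole_sum _ (primes `|coprime_part P a|)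
    (fun p => 2 * D p) (size X); last first.
  by exists a, p; split => //; move: pX; rewrite /D mulnCA mulnA.
rewrite X_gt0 -big_distrr /=; apply: leq_trans Xa _; rewrite leq_mul2l /=.
under [leqRHS]eq_bigr do rewrite /D count_sum.
rewrite [leqRHS]exchange_big /= big_seq [leqRHS]big_seq; apply: leq_sum => b bX.
have [//|] := boolP (coprime_parts P a b).
rewrite /coprime_parts coprime_has_primes ?absz_gt0 ?cop0 // negbK.
case/hasP=> p pb pa; rewrite (big_rem p) //=.
by rewrite [p \in _]pb.
Qed.

End CoprimePart.

(** * Adding primes until the coprime parts are few *)

Section Iteration.
Local Open Scope nat_scope.

(** The invariant of the iteration.  The last field records the accumulated
loss: the [i]-th added prime, [i] counted from [0], costs a factor
[2 * (k - i) * m]. *)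
Record regular_subset (A : seq int) (k m : nat) (P : seq nat) (X : seq int)
    (l : nat) : Prop := RegularSubset {
  regular_uniq_primes : uniq P;
  regular_prime : all prime P;
  regular_uniq : uniq X;
  regular_sub : {subset X <= A};
  regular_nonempty : 0 < size X;
  regular_dvd : forall a, a \in X -> {subset P <= primes `|a|};
  regular_gt0 : 0 < l;
  regular_fiber : forall a, a \in X ->
    l <= fiber_size (coprime_part P) X a <= 2 * l;
  regular_size : size A <= (2 * m) ^ size P * k ^_ (size P) * size X }.

(** The primes of [P] and those of the coprime part of [a] are distinct primes
of [a]; this leaves at most [k - size P] candidates for the new prime, and also
gives [size P < k]. *)
Lemma regular_step (A : seq int) (k m : nat) (P : seq nat) (X : seq int) l :
  0 < m -> size A < 2 ^ m.+1 -> 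
  (forall a, a \in A -> a != 0%R) ->
  (forall a, a \in A -> size (primes `|a|) <= k) ->
  regular_subset A k m P X l ->
  2 * \sum_(a <- X) \sum_(b <- X) coprime_parts P a b < size X ^ 2 ->
  exists p X' l', size P < k /\ regular_subset A k m (p :: P) X' l'.
Proof.
move=> m_gt0 A_lt A0 Ak [uP prP uX XA X_gt0 PX l_gt0 Xl A_le] few.
have [|a [p [aX pa le_p]]] := popular_prime _ few; first by move=> a /XA /A0.
have a0 := A0 a (XA a aX).
pose Y := [seq b <- X | p \in primes `|coprime_part P b|].
have sY : count (fun b => p \in primes `|coprime_part P b|) X = size Y.
  by rewrite size_filter.
move: (pa); rewrite primes_coprime_part // => /andP[pP pa'].
have Pk : size (primes `|coprime_part P a|) <= k - size P.
  have : {subset P ++ primes `|coprime_part P a| <= primes `|a|}.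
    move=> q; rewrite mem_cat primes_coprime_part // => /orP[/(PX a aX)//|].
    by case/andP.
  move/uniq_leq_size; rewrite cat_uniq uP primes_uniq andbT /= size_cat.
  have -> : ~~ has (in_mem^~ (mem P)) (primes `|coprime_part P a|).
    by apply/hasPn => q; rewrite primes_coprime_part // => /andP[].
  by move/(_ isT); have := Ak a (XA a aX); lia.
have P_lt : size P < k.
  by case: (primes _) pa Pk => //= *; lia.
have Y_gt0 : 0 < size Y by move: le_p; rewrite sY; case: (size Y) => //; lia.
have Y_lt : size Y < 2 ^ m.+1.
  apply: leq_ltn_trans A_lt; rewrite size_filter; apply: leq_trans (count_size _ _) _.
  exact: uniq_leq_size.
have [|l' l'_gt0 Yl] := @dyadic_fibers _ _ (coprime_part (p :: P)) Y m m_gt0.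
  by rewrite Y_gt0.
pose Q b := l' <= fiber_size (coprime_part (p :: P)) Y b <= 2 * l'.
have Yl' : size Y <= m * count Q Y := Yl.
have sY' : size [seq b <- Y | Q b] = count Q Y by rewrite size_filter.
exists p, [seq b <- Y | Q b], l'; split=> //; split => //=.
- by rewrite pP.
- by move: pa'; rewrite mem_primes => /andP[-> _].
- by rewrite !filter_uniq.
- by move=> b; rewrite !mem_filter => /and3P[_ _ /XA].
- by rewrite sY' lt0n; apply: contraTneq Yl' => ->; rewrite muln0 -ltnNge.
- move=> b; rewrite !mem_filter => /and3P[_ pb bX] q.
  have b0 := A0 b (XA b bX).
  move: pb; rewrite primes_coprime_part // => /andP[_ pb].
  by rewrite inE => /orP[/eqP->//|/(PX b bX)].
- move=> b; rewrite mem_filter => /andP[Qb _].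
  by rewrite fiber_size_filter // => c eq_c; rewrite /Q /fiber_size eq_c.
apply: leq_trans A_le _; rewrite expnSr ffactnSr sY'.
rewrite sY in le_p.
rewrite -!mulnA leq_mul2l; apply/orP; right.
rewrite (mulnCA m) (mulnCA 2) leq_mul2l; apply/orP; right.
apply: leq_trans le_p _; rewrite -mulnA leq_mul2l /= mulnCA.
exact: leq_mul.
Qed.

(** The number of primes increases at each step and stays at most [k], so at
some point at least half of the pairs have coprime coprime parts. *)
Lemma regular_subset_few_parts (A T : seq int) (k m : nat) P X l :
  0 < m -> size A < 2 ^ m.+1 ->
  (forall a, a \in A -> a != 0%R) ->
  (forall a, a \in A -> size (primes `|a|) <= k) ->
  {in A &, forall a b, (a * b)%R \in T} ->
  size P <= k -> regular_subset A k m P X l ->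
  exists P' X' l', [/\ size P' <= k, regular_subset A k m P' X' l' &
    size (undup (map (coprime_part P') X')) * size X' <= 4 ^ (k + 2) * size T].
Proof.
move=> m_gt0 A_lt A0 Ak AT.
have [d] := ubnP (k - size P); elim: d P X l => // d IH P X l dP Pk reg.
have [few|many] := ltnP (2 * \sum_(a <- X) \sum_(b <- X) coprime_parts P a b)
  (size X ^ 2).
  have [p [X' [l' [P_lt reg']]]] := regular_step m_gt0 A_lt A0 Ak reg few.
  by apply: (IH (p :: P) X' l') => //=; lia.
exists P, X, l; split=> //.
case: reg => uP prP uX XA X_gt0 PX l_gt0 Xl A_le.
have : \sum_(a <- X) \sum_(b <- X) coprime_parts P a b
    <= size T * (2 * 4 ^ k * (2 * l)).
  apply: coprime_pairs_bound => //.
  - by move=> a b /XA aA /XA bA; exact: AT.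
  - by move=> a /XA /A0.
  - move=> a aX; have a0 := A0 a (XA a aX).
    apply: leq_trans (Ak a (XA a aX)).
    apply: uniq_leq_size (primes_uniq _) _ => q.
    by rewrite primes_coprime_part // => /andP[].
  - by move=> a /Xl /andP[].
move=> few_pairs.
have Bl : size (undup (map (coprime_part P) X)) * l <= size X.
  by apply: fibers_lower_bound => a /Xl /andP[].
move: many few_pairs Bl X_gt0; rewrite expnD.
move: (\sum_(a <- X) _) (size (undup _)) (size X) (size T) (4 ^ k).
move=> S b n t q le1 le2 le3 n_gt0.
rewrite -(leq_pmul2r n_gt0).
have h1 : n ^ 2 <= 8 * (t * q) * l by lia.
have h2 : b * n ^ 2 <= 8 * (t * q) * (b * l).
  by rewrite mulnCA leq_mul2l (leq_trans h1) ?orbT.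
have h3 : 8 * (t * q) * (b * l) <= 8 * (t * q) * n by rewrite leq_mul2l le3 orbT.
nia.
Qed.

End Iteration.

(** * Valuations, logarithms and the theorem *)

Section Packaging.

Lemma prod_pow_logn (P : seq nat) (n : nat) : uniq P -> (0 < n)%N ->
  (\prod_(p <- P) p ^ logn p n = n`_([pred p in P] : nat_pred))%N.
Proof.
move=> uP n0; rewrite /partn.
transitivity (\prod_(p <- P | (p < n.+1)%N) p ^ logn p n)%N.
  rewrite [RHS]big_mkcond; apply: eq_bigr => p _.
  by case: ltnP => // np; rewrite ltn_log0.
rewrite -[LHS]big_filter -[RHS]big_filter; apply: perm_big.
apply: uniq_perm; rewrite ?filter_uniq ?iota_uniq // => p.
by rewrite !mem_filter mem_index_iota /= andbC.
Qed.

Definition valuations (P : seq nat) (a : int) : 'rV[int]_(size P) :=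
  \row_i (logn (nth 0%N P i) `|a|%N)%:Z.

Lemma prime_power_valuations (P : seq nat) (a : int) : uniq P -> a != 0 ->
  prime_power (fun i : 'I_(size P) => nth 0%N P i) (valuations P a) =
    ((`|a|%N)`_([pred p in P] : nat_pred))%:R.
Proof.
move=> uP a0; rewrite -prod_pow_logn ?absz_gt0 // (big_nth 0%N) big_mkord.
rewrite natr_prod; apply: eq_bigr => i _.
by rewrite mxE -exprnP natrX.
Qed.

Lemma coprime_part_nil (a : int) : coprime_part [::] a = a.
Proof.
have [->|a0] := eqVneq a 0; first by rewrite /coprime_part mul0r.
by rewrite [RHS](coprime_partK [::] a0) /partn big_pred0 ?mul1r.
Qed.

Lemma rat_decomposition (P : seq nat) (a : int) : a != 0 ->
  ((`|a|%N)`_([pred p in P] : nat_pred))%:R * (coprime_part P a)%:~R = a%:~R :> rat.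
Proof.
by move=> a0; rewrite [in RHS](coprime_partK P a0) intrM.
Qed.

Lemma coprimez_coprime_part (P : seq nat) (a : int) : all prime P -> a != 0 ->
  coprimez (coprime_part P a) (\prod_(i < size P) (nth 0%N P i)%:Z).
Proof.
move=> prP a0; apply: (big_ind (fun b => coprimez (coprime_part P a) b)).
- by rewrite coprimezE coprimen1.
- by move=> x y; rewrite coprimezMr => -> ->.
move=> i _; rewrite coprimezE absz_coprime_part // absz_nat coprime_sym.
have iP : nth 0%N P i \in P by exact: mem_nth.
rewrite prime_coprime ?(allP prP) //; apply/negP => dv.
have : nth 0%N P i \in primes `|coprime_part P a|%N.
  by rewrite mem_primes absz_coprime_part // part_gt0 dv (allP prP).
by rewrite primes_coprime_part // iP.
Qed.

Lemma trunc_log_le_log2 (R : realType) (n : nat) : (0 < n)%N ->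
  (trunc_log 2 n)%:R <= log2 n%:R :> R.
Proof.
move=> n0; rewrite /log2 ler_pdivlMr ?ln_gt0 ?ltr1n //.
rewrite mulr_natl -lnXn ?ltr0n // ler_ln ?posrE ?exprn_gt0 ?ltr0n //.
by rewrite -natrX ler_nat trunc_logP.
Qed.

Lemma omega_leE (a : int) (k : nat) : (omega a <= (k%:Z)%:E)%E ->
  a != 0 /\ (size (primes `|a|%N) <= k)%N.
Proof.
by rewrite /omega; case: eqP => // _; rewrite lee_fin lez_nat.
Qed.

End Packaging.

Theorem theorem4p2 (R : realType) (k : nat) (K : R) (A : {fset int})
    (k_gt0 : (0 < k)%N)
    (A_ge2 : (2 <= #|` A|)%N)
    (A_omega : forall a : int, a \in A -> (omega a <= (k%:Z)%:E)%E)
    (A_doubling : (#|` product_set A|)%:R <= K * (#|` A|)%:R) :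
  exists (r : nat) (p : 'I_r -> nat) (A' : {fset int}),
    [/\ (r <= k)%N,
        injective p /\ (forall i, prime (p i)),
        (A' `<=` A)%fset,
        (#|` A|)%:R / (2 ^+ k * (k`!)%:R * log2 (#|` A|)%:R ^+ k)
          <= (#|` A'|)%:R :> R &
        exists (V : set 'rV[int]_r) (Bv : 'rV[int]_r -> {fset int})
               (B : {fset int}) (Gamma : int -> {fset rat}) (L : R),
          [/\ V `<=` @nonneg_vectors r
              /\ (forall v, V v -> forall b : int, b \in Bv v ->
                   coprimez b (\prod_(i < r) (p i)%:Z)),
              [set` B] = \bigcup_(v in V) [set` Bv v],
              ratset A' = \bigcup_(v in V) dilate (prime_power p v) (ratset (Bv v))
              /\ ratset A' = \bigcup_(b in [set` B]) dilate b%:~R [set` Gamma b],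
              (#|` B|)%:R <= 4 ^+ (k + 2) * K * (#|` A|)%:R / (#|` A'|)%:R &
              1 <= L /\ (forall b : int, b \in B ->
                [set` Gamma b] `<=` prime_group p
                /\ L <= (#|` Gamma b|)%:R <= 2 * L)]].
Proof.
have A0 a : a \in A -> a != 0 by move=> /A_omega /omega_leE[].
have Ak a : a \in A -> (size (primes `|a|%N) <= k)%N by move=> /A_omega /omega_leE[].
have A_gt0 : (0 < #|` A|)%N by exact: ltnW.
set m := trunc_log 2 #|` A|.
have m_gt0 : (0 < m)%N by rewrite trunc_log_gt0.
have A_lt : (#|` A| < 2 ^ m.+1)%N by exact: trunc_log_ltn.
(* For no primes at all the coprime part is the identity, with fibers of size 1. *)
have reg0 : regular_subset (enum_fset A) k m [::] (enum_fset A) 1.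
  split=> //; first exact: fset_uniq; last by rewrite expn0 ffactn0 !mul1n.
  move=> a aA; rewrite fiber_size_gt0 //=.
  rewrite /fiber_size (eq_count (a2 := pred1 a)) => [|b /=].
    by rewrite count_uniq_mem ?fset_uniq // aA.
  by rewrite !coprime_part_nil.
have AA : {in enum_fset A &, forall a b, a * b \in enum_fset (product_set A)}.
  by move=> a b aA bA; apply/imfset2P; exists a => //; exists b.
have [P [X [l [Pk [uP prP uX XA X_gt0 PX l_gt0 Xl A_le] few]]]] :=
  regular_subset_few_parts m_gt0 A_lt A0 Ak AA (leq0n k : (size [::] <= k)%N) reg0.
have X0 a : a \in X -> a != 0 by move=> /XA /A0.
pose p (i : 'I_(size P)) := nth 0%N P i.
pose part (a : int) : rat := ((`|a|%N)`_([pred p in P] : nat_pred))%:R.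
pose A' := [fset a in X]%fset.
have mA' a : (a \in A') = (a \in X) by rewrite inE.
have sA' : #|` A'| = size X.
  by rewrite /A' card_fseq undup_id.
pose Bv v := [fset coprime_part P a | a in [fset a in A' | valuations P a == v]]%fset.
pose B := [fset coprime_part P a | a in A']%fset.
pose Gamma b := [fset part a | a in [fset a in A' | coprime_part P a == b]]%fset.
have BvP v b : b \in Bv v ->
    exists a, [/\ a \in X, valuations P a = v & coprime_part P a = b].
  by case/imfsetP=> a /=; rewrite !inE => /andP[aX /eqP <-] ->; exists a.
have inBv a : a \in X -> coprime_part P a \in Bv (valuations P a).
  by move=> aX; apply/imfsetP; exists a => //=; rewrite !inE aX eqxx.
have inGamma a : a \in X -> part a \in Gamma (coprime_part P a).
  by move=> aX; apply/imfsetP; exists a => //=; rewrite !inE aX eqxx.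
have GammaP b g : g \in Gamma b ->
    exists a, [/\ a \in X, coprime_part P a = b & part a = g].
  by case/imfsetP=> a /=; rewrite !inE => /andP[aX /eqP <-] ->; exists a.
have BP b : b \in B -> exists2 a, a \in X & b = coprime_part P a.
  by case/imfsetP=> a /=; rewrite mA' => aX ->; exists a.
have inB a : a \in X -> coprime_part P a \in B.
  by move=> aX; apply/imfsetP; exists a => //=; rewrite mA'.
have nonneg a : nonneg_vectors (valuations P a) by move=> i; rewrite mxE.
have card_Gamma a : a \in X ->
    #|` Gamma (coprime_part P a)| = fiber_size (coprime_part P) X a.
  move=> aX; rewrite /Gamma card_in_imfset /=; last first.
    (* On a fiber of coprime_part, the P-part determines the element. *)
    move=> x y; rewrite !inE => /andP[xX /eqP ex] /andP[yX /eqP ey] eq_part.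
    apply: (@intr_inj rat); rewrite -(rat_decomposition P (X0 x xX)).
    by rewrite -(rat_decomposition P (X0 y yX)) ex ey -/(part x) eq_part.
  rewrite /fiber_size -size_filter; apply: perm_size; apply: uniq_perm.
  - exact: fset_uniq.
  - exact: filter_uniq.
  by move=> x; rewrite mem_filter !inE andbC.
have sB : #|` B| = size (undup (map (coprime_part P) X)).
  apply: perm_size; apply: uniq_perm; rewrite ?fset_uniq ?undup_uniq // => b.
  rewrite mem_undup; apply/idP/mapP => [/BP//|[a aX ->]]; exact: inB.
exists (size P), p, A'; split=> //.
- split=> [i j /eqP|i]; last by rewrite (allP prP) // mem_nth.
  by rewrite nth_uniq // => /eqP /val_inj.
- by apply/fsubsetP => a; rewrite mA' => /XA.
- have m_le : m%:R <= log2 (#|` A|)%:R :> R by exact: trunc_log_le_log2.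
  have log_gt0 : 0 < log2 (#|` A|)%:R :> R.
    by apply: lt_le_trans m_le; rewrite ltr0n.
  rewrite ler_pdivrMr ?mulr_gt0 ?exprn_gt0 ?ltr0n ?fact_gt0 // sA'.
  apply: (@le_trans _ _ ((size X * (2 ^ k * k`! * m ^ k))%N%:R)).
    rewrite ler_nat; apply: leq_trans A_le _.
    rewrite mulnC leq_mul2l; apply/orP; right.
    rewrite mulnAC -expnMn; apply: leq_mul.
      by rewrite leq_pexp2l // muln_gt0.
    by rewrite -(ffact_fact Pk) leq_pmulr ?fact_gt0.
  rewrite !natrM !natrX; apply: ler_wpM2l => //.
  apply: ler_wpM2l; first by rewrite mulr_ge0 ?exprn_ge0.
  by rewrite lerXn2r ?nnegrE // ltW.
exists (@nonneg_vectors (size P)), Bv, B, Gamma, l%:R; split.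
- split=> // v _ b /BvP[a [aX _ <-]].
  by apply: coprimez_coprime_part => //; exact: X0.
- apply/seteqP; split=> b /=.
    by case/BP=> a aX ->; exists (valuations P a) => //=; exact: inBv.
  by case=> v _ /BvP[a [aX _ <-]]; exact: inB.
- split; apply/seteqP; split=> q /=.
  + case=> a /=; rewrite mA' => aX <-; exists (valuations P a) => //.
    exists (coprime_part P a)%:~R; first by exists (coprime_part P a) => //=; exact: inBv.
    by rewrite prime_power_valuations ?X0 // rat_decomposition ?X0.
  + case=> v _ [_ [b /BvP[a [aX <- <-]] <-] <-]; exists a; first by rewrite /= mA'.
    by rewrite prime_power_valuations ?X0 // rat_decomposition ?X0.
  + case=> a /=; rewrite mA' => aX <-; exists (coprime_part P a); first exact: inB.
    by exists (part a); [exact: inGamma | rewrite mulrC rat_decomposition ?X0].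
  + case=> b _ [g /GammaP[a [aX <- <-]] <-]; exists a; first by rewrite /= mA'.
    by rewrite mulrC rat_decomposition ?X0.
- rewrite ler_pdivlMr ?ltr0n sA' // sB.
  apply: (@le_trans _ _ ((4 ^ (k + 2) * #|` product_set A|)%N%:R)).
    by rewrite -natrM ler_nat.
  by rewrite natrM natrX -mulrA ler_wpM2l ?exprn_ge0.
split; first by rewrite ler1n.
move=> b /BP[a aX ->]; split; last first.
  by rewrite card_Gamma // -natrM !ler_nat; exact: Xl.
move=> g /GammaP[c [cX _ <-]]; exists (valuations P c) => //.
by rewrite prime_power_valuations ?X0.
Qed.
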